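(* Let $H$ be a complex Hilbert space with $\dim H\ge 3$ and let $k\ge 1$ be an integer. If the dimension of $H$ is finite and greater than $2k$, then every transformation $f$ of ${\mathcal G}_{k}(H)$ preserving the orthogonality relation in both directions is a bijective transformation of ${\mathcal G}_{k}(H)$ induced by a unitary or anti-unitary operator on $H$, i.e. there is a unitary or anti-unitary operator $U$ on $H$ such that $f(X)=U(X)$ for every $X\in{\mathcal G}_{k}(H)$.
   Context: ${\mathcal G}_{k}(H)$ is the set of all $k$-dimensional subspaces of $H$. A transformation of a set is a (not necessarily injective or surjective) mapping of that set to itself. Two elements $X,Y\in{\mathcal G}_{k}(H)$ are orthogonal ($X\perp Y$) if every vector of $X$ is orthogonal to every vector of $Y$. A transformation $f$ preserves the orthogonality relation in both directions if $X\perp Y\Leftrightarrow f(X)\perp f(Y)$ for all $X,Y$. *)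

(* Defs.v *)
From mathcomp Require Import all_boot all_order all_algebra.
From mathcomp Require Import classical_sets reals complex.

Set Implicit Arguments.
Unset Strict Implicit.
Unset Printing Implicit Defensive.

Import Order.TTheory GRing.Theory Num.Theory.
Local Open Scope ring_scope.
Local Open Scope complex_scope.
Local Open Scope classical_set_scope.

(* A finite-dimensional complex Hilbert space is a [vectType R[i]], [R] being
   the reals, with a positive definite hermitian form, linear in its first
   argument and conjugate-linear in its second; completeness is automatic in
   finite dimension. *)
Notation inner_product H := {dot H for Num.conj}.

Definition grassmannian (R : realType) (H : vectType R[i]) (k : nat) : Type :=
  {X : {vspace H} | \dim X == k}.

Definition orthogonal_spaces (R : realType) (H : vectType R[i])
    (form : inner_product H) (X Y : {vspace H}) : Prop :=
  {in X & Y, forall x y, form x y = 0}.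

Definition preserves_orthogonality (R : realType) (H : vectType R[i])
    (form : inner_product H) (k : nat)
    (f : grassmannian H k -> grassmannian H k) : Prop :=
  forall X Y : grassmannian H k,
    orthogonal_spaces form (val X) (val Y) <->
    orthogonal_spaces form (val (f X)) (val (f Y)).

Definition unitary_operator (R : realType) (H : vectType R[i])
    (form : inner_product H) (U : H -> H) : Prop :=
  [/\ linear U, bijective U & isometry form form U].

Definition antiunitary_operator (R : realType) (H : vectType R[i])
    (form : inner_product H) (U : H -> H) : Prop :=
  [/\ linear_for (Num.conj \; *:%R) U, bijective U
    & forall u v : H, form (U u) (U v) = Num.conj (form u v)].

(* Equality of sets of vectors: the image of a subspace under a
   conjugate-linear map is not available as a {vspace H}. *)
Definition induced_by (R : realType) (H : vectType R[i]) (k : nat)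
    (f : grassmannian H k -> grassmannian H k) (U : H -> H) : Prop :=
  forall X : grassmannian H k, [set` val (f X)] = U @` [set` val X].

(* Main.v *)
From HB Require Import structures.
Require Import Defs.
From mathcomp Require Import all_boot all_order all_algebra.
From mathcomp Require Import boolp classical_sets reals complex.
From mathcomp Require Import zify ring.

Set Implicit Arguments.
Unset Strict Implicit.
Unset Printing Implicit Defensive.

Import Order.TTheory GRing.Theory Num.Theory.
Local Open Scope ring_scope.

(** Write n for the dimension of H and S^⊥ for orthocomplements.  Two
    k-subspaces are adjacent when their span has dimension k+1.

    The map F induced on k-subspaces is injective, because 2k < n lets a
    k-subspace of Y^⊥ detect any X not contained in Y.  It also sends the
    k-subspaces of a (k+1)-space W into one (k+1)-space A W.  Indeed, climbing
    in W^⊥ through a chain of subspaces of dimensions k, k+1, ..., n-k-1 makes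
    the span of the images grow strictly at each step ([chain_bound]), so at
    least n-k-1 dimensions are orthogonal to all F X with X in W
    ([hull_exists]).

    Next F is pushed down to smaller subspaces ([descent]).  Given maps A on
    (d+2)-spaces and B on (d+1)-spaces that respect incidence and are injective
    on adjacent pairs, all the B X with X containing a fixed d-space S share a
    d-space: three X that do not lie in one (d+2)-space have images that
    do not lie in one (d+2)-space either, so their pairwise intersections
    coincide ([star_center]).  This defines a map g on d-spaces.  The
    delicate point is that g is again injective on adjacent pairs
    ([descent_injective]): if not, there are R and P with dim R < dim P <= k
    such that R <= X implies P <= F X.  Since F moves adjacent spaces to
    adjacent or equal ones, F X then meets P for every X whatsoever
    ([meets_common_part]), which fails for X orthogonal to some X1 containing R.
    At d = 1 one gets an injective map L on lines that preserves orthogonality,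
    with L p <= F X whenever p <= X.  By injectivity L also reflects
    orthogonality ([line_gen_orthE]).

    It remains to treat lines.  In coordinates for an orthonormal basis e_i and
    its image, orthogonality to e_0 + s e_j alone forces a vector with
    coordinates (1, x_1, x_2, ...) to be sent to the line of
    (1, a_1(x_1), a_2(x_2), ...) ([image_coord]), and orthogonality of such
    vectors becomes a functional equation for pairs of the functions a_j
    ([line_equation]).  The equation forces a_j(x) = a_j(1) s(x) with
    |a_j(1)| = 1 and one field endomorphism s for all j, commuting with
    conjugation ([line_equation_endomorphism]); such an endomorphism of the
    complex field is the identity or the conjugation
    ([endomorphism_id_or_conj]).  Hence L is induced by a unitary or antiunitary
    U ([image_line]).  Finally U maps X into F X, and testing vectors of F X
    against the k-subspaces of X^⊥ gives the converse inclusion. *)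

(** * Subspaces and orthocomplements *)

Section Subspaces.
Variables (K : fieldType) (V : vectType K).
Implicit Types (S T U W X Y : {vspace V}) (d : nat).

Lemma subspace_between U W d :
  (U <= W)%VS -> (\dim U <= d <= \dim W)%N ->
  exists2 X, (U <= X <= W)%VS & \dim X = d.
Proof.
move=> UW; elim: d => [|d IHd] /andP[Ud dW].
  by exists U; [rewrite subvv | apply/eqP; rewrite -leqn0].
case: (leqP (\dim U) d) => [Ud'|dU]; last first.
  by exists U; [rewrite subvv | apply/eqP; rewrite eqn_leq Ud].
have /IHd[X /andP[UX XW] dX] : (\dim U <= d <= \dim W)%N by rewrite Ud' ltnW.
have /subvPn[w wW wX] : ~~ (W <= X)%VS.
  by apply/negP => /dimvS; rewrite dX leqNgt dW.
exists (X + <[w]>)%VS.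
  by rewrite (subv_trans UX (addvSl _ _)) subv_add XW.
have w0 : w != 0 by apply: contraNneq wX => ->; rewrite mem0v.
rewrite dimv_disjoint_sum ?dX ?dim_vline ?w0 ?addn1 //.
apply/eqP; rewrite -subv0; apply/subvP => x /memv_capP[xX /vlineP[a xE]].
rewrite memv0; move: xX; rewrite xE; have [->|a0] := eqVneq a 0.
  by rewrite scale0r.
by move=> /(memvZ a^-1); rewrite scalerK // (negPf wX).
Qed.

Lemma subspace_through x W d : x \in W -> (0 < d <= \dim W)%N ->
  exists2 X, (<[x]> <= X <= W)%VS & \dim X = d.
Proof.
move=> xW /andP[d_gt0 dW]; apply: subspace_between; rewrite -?memvE // dW andbT.
by rewrite dim_vline (leq_trans (leq_b1 _)).
Qed.

Lemma eq_of_sub_dim U W : (U <= W)%VS -> (\dim W <= \dim U)%N -> U = W.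
Proof. by move=> UW dWU; apply/eqP; rewrite eqEdim UW. Qed.

Lemma addv_adjacent d X Y S : \dim X = d.+1 -> \dim Y = d.+1 -> (d <= \dim S)%N ->
  (S <= X)%VS -> (S <= Y)%VS -> X != Y -> \dim (X + Y) = d.+2.
Proof.
move=> dX dY dS SX SY XY; have := dimv_sum_cap X Y.
have := @dimvS _ _ S (X :&: Y); rewrite subv_cap SX SY => /(_ isT).
suff : (\dim (X :&: Y) < d.+1)%N by lia.
rewrite ltnNge; apply: contra XY => dXY; apply/eqP.
rewrite -(@eq_of_sub_dim (X :&: Y) X) ?capvSl ?dX //.
by apply: eq_of_sub_dim; rewrite ?capvSr ?dY.
Qed.

Lemma dim_addv_line S v : (\dim (S + <[v]>) <= (\dim S).+1)%N.
Proof.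
have := dimv_sum_cap S <[v]>%VS; rewrite dim_vline.
by case: (v != 0) => /=; clear; lia.
Qed.

End Subspaces.

Section Orthogonality.
Variables (C : numClosedFieldType) (H : vectType C).
Variable form : {dot H for Num.conj}.
Implicit Types (U W X Y : {vspace H}).
Local Notation perp := (orthov form).

Lemma orthov_anti U W : (U <= W)%VS -> (perp W <= perp U)%VS.
Proof.
by move=> UW; rewrite orthov_sym; apply: subv_trans UW _; rewrite orthov_sym.
Qed.

Lemma capv_orthov U : (U :&: perp U = 0)%VS.
Proof.
apply/eqP; rewrite -subv0; apply/subvP => x /memv_capP[xU /mem_orthovP xU'].
by rewrite memv0 -(dnorm_eq0 form) xU'.
Qed.

Lemma addv_orthov U : (U + perp U = fullv)%VS.
Proof.
apply/eqP; rewrite eqEsubv subvf; apply/subvP => x _.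
have [y yU [z [-> _ zU]]] := orthogonal_split form (vbasis U) x.
rewrite memv_add //; first by rewrite (span_basis (vbasisP U)) in yU.
move: zU; rewrite orthogonalE (span_basis (vbasisP U)) => /subvP.
by apply; rewrite memv_span ?mem_head.
Qed.

Lemma dim_orthov U : (\dim U + \dim (perp U) = \dim {:H})%N.
Proof.
by have := dimv_sum_cap U (perp U); rewrite capv_orthov addv_orthov dimv0 addn0.
Qed.

Lemma leq_dim_orthov d U : \dim U = d -> (2 * d < \dim {:H})%N ->
  (d <= \dim (perp U))%N.
Proof. by move=> dU; rewrite -(dim_orthov U) dU; clear; lia. Qed.

Lemma orthovK : involutive perp.
Proof.
move=> U; apply/esym/eq_of_sub_dim; first by rewrite orthov_sym.
by have := dim_orthov U; have := dim_orthov (perp U); lia.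
Qed.

Lemma orthov_disjoint X Y P :
  (X <= perp Y)%VS -> (P <= X)%VS -> (P <= Y)%VS -> P = 0%VS.
Proof.
move=> XY PX PY; apply/eqP; rewrite -subv0 -(capv_orthov Y) subv_cap PY.
exact: subv_trans XY.
Qed.

Lemma orthogonal_separation X W d : (0 < d)%N -> (d <= \dim (perp W))%N ->
  ~~ (X <= W)%VS ->
  exists Y, [/\ \dim Y = d, (Y <= perp W)%VS & ~~ (X <= perp Y)%VS].
Proof.
move=> d_gt0 dW /subvPn[x xX xW].
move: xW; rewrite -{1}(orthovK W) => /mem_orthovPn[y yW xy].
have [Y /andP[yY YW] dY] : exists2 Y, (<[y]> <= Y <= perp W)%VS & \dim Y = d.
  by apply: subspace_through; rewrite ?d_gt0.
exists Y; split=> //; apply/negP => /subvP /(_ x xX) /mem_orthovP /(_ y).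
by rewrite memvE => /(_ yY)/eqP; rewrite (negPf xy).
Qed.

End Orthogonality.

(** * Maps on subspaces and their restriction to stars *)

Section SubspaceMaps.
Variables (K : fieldType) (V : vectType K).
Implicit Types (A B g : {vspace V} -> {vspace V}) (S T U W X Y : {vspace V}).

Definition rank_preserving d g := forall X, \dim X = d -> \dim (g X) = d.

Definition adjacent_injective d g := forall X Y,
  \dim X = d -> \dim Y = d -> \dim (X + Y) = d.+1 -> g X <> g Y.

Definition incident d e B A := forall S W,
  \dim S = d -> \dim W = e -> (S <= W)%VS -> (B S <= A W)%VS.

Section Layers.
Variables (d : nat) (A B : {vspace V} -> {vspace V}).
Hypotheses (A_rank : rank_preserving d.+1 A) (B_rank : rank_preserving d B).
Hypotheses (BA : incident d d.+1 B A).
Hypothesis B_inj : adjacent_injective d B.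

(** Dimension count: [B S] and [B T] are distinct and lie in [A W]. *)
Lemma image_span S T W : \dim S = d -> \dim T = d -> S != T -> \dim W = d.+1 ->
  (S <= W)%VS -> (T <= W)%VS -> (B S + B T = A W)%VS.
Proof.
move=> dS dT ST dW SW TW.
have STW : (S + T = W)%VS.
  apply: eq_of_sub_dim; first by rewrite subv_add SW.
  rewrite dW ltnNge; apply: contra ST => dST.
  rewrite (@eq_of_sub_dim _ _ S (S + T)%VS) ?addvSl ?dS //.
  by apply/eqP/esym/eq_of_sub_dim; rewrite ?addvSr ?dT.
apply: eq_of_sub_dim; first by rewrite subv_add !BA.
rewrite A_rank // ltnNge; apply/negP => dBST.
have := @B_inj S T dS dT; rewrite STW => /(_ dW); apply.
have BSE : (B S = B S + B T)%VS.
  by apply: eq_of_sub_dim; rewrite ?addvSl ?B_rank.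
by apply/esym/eq_of_sub_dim; rewrite ?B_rank // BSE addvSr.
Qed.

Lemma dim_image_cap S T W : \dim S = d -> \dim T = d -> S != T -> \dim W = d.+1 ->
  (S <= W)%VS -> (T <= W)%VS -> (\dim (B S :&: B T)).+1 = d.
Proof.
move=> dS dT ST dW SW TW; have := dimv_sum_cap (B S) (B T).
by rewrite (image_span dS dT ST dW) // A_rank // !B_rank //; clear; lia.
Qed.

End Layers.

Section Star.
Variables (d : nat) (A B : {vspace V} -> {vspace V}).
Hypotheses (A_rank : rank_preserving d.+2 A) (B_rank : rank_preserving d.+1 B).
Hypotheses (BA : incident d.+1 d.+2 B A).
Hypotheses (A_inj : adjacent_injective d.+2 A) (B_inj : adjacent_injective d.+1 B).

(** If [B X1] and [B X2] met [B X3] in different subspaces, these would span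
    [B X3], which would then lie in [A (X1 + X2)]; but this would make [A]
    identify the adjacent spaces [X1 + X2] and [X1 + X3]. *)
Lemma star_cap_out S X1 X2 X3 : \dim S = d ->
  \dim X1 = d.+1 -> \dim X2 = d.+1 -> \dim X3 = d.+1 ->
  (S <= X1)%VS -> (S <= X2)%VS -> (S <= X3)%VS ->
  X1 != X2 -> ~~ (X3 <= X1 + X2)%VS -> (B X1 :&: B X2 <= B X3)%VS.
Proof.
move=> dS d1 d2 d3 S1 S2 S3 X12 X312.
have dS' : (d <= \dim S)%N by rewrite dS.
have d12 := addv_adjacent d1 d2 dS' S1 S2 X12.
have X13 : X1 != X3 by apply: contraNneq X312 => <-; rewrite addvSl.
have X23 : X2 != X3 by apply: contraNneq X312 => <-; rewrite addvSr.
have d13 := addv_adjacent d1 d3 dS' S1 S3 X13.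
have d23 := addv_adjacent d2 d3 dS' S2 S3 X23.
have s12 := image_span A_rank B_rank BA B_inj d1 d2 X12 d12 (addvSl _ _) (addvSr _ _).
have s13 := image_span A_rank B_rank BA B_inj d1 d3 X13 d13 (addvSl _ _) (addvSr _ _).
have c12 := dim_image_cap A_rank B_rank BA B_inj d1 d2 X12 d12 (addvSl _ _) (addvSr _ _).
have c13 := dim_image_cap A_rank B_rank BA B_inj d1 d3 X13 d13 (addvSl _ _) (addvSr _ _).
have c23 := dim_image_cap A_rank B_rank BA B_inj d2 d3 X23 d23 (addvSl _ _) (addvSr _ _).
have B3N : ~~ (B X3 <= A (X1 + X2))%VS.
  apply/negP => B3.
  have A1213 : A (X1 + X2)%VS = A (X1 + X3)%VS.
    apply/esym/eq_of_sub_dim; last by rewrite !A_rank.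
    by rewrite -s13 subv_add B3 -s12 addvSl.
  have X1A : (X1 <= (X1 + X2) :&: (X1 + X3))%VS by rewrite subv_cap !addvSl.
  have X123 : (X1 + X2)%VS != (X1 + X3)%VS.
    by apply: contraNneq X312 => ->; rewrite addvSr.
  apply: (A_inj d12 d13 _ A1213).
  by apply: (addv_adjacent d12 d13 _ (addvSl _ _) (addvSl _ _) X123); rewrite d1.
have cA : (\dim (B X3 :&: A (X1 + X2)) <= d)%N.
  rewrite -ltnS ltn_neqAle -{2}(B_rank d3) dimvS ?capvSl // andbT.
  apply: contra B3N => /eqP dB3.
  apply/capv_idPl/eq_of_sub_dim; rewrite ?capvSl // dB3 B_rank //.
have E1 : (B X3 :&: B X1 = B X3 :&: A (X1 + X2))%VS.
  apply: eq_of_sub_dim; first by rewrite capvS // -s12 addvSl.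
  by rewrite (capvC (B X3) (B X1)); move: c13 cA; clear; lia.
have E2 : (B X3 :&: B X2 = B X3 :&: A (X1 + X2))%VS.
  apply: eq_of_sub_dim; first by rewrite capvS // -s12 addvSr.
  by rewrite (capvC (B X3) (B X2)); move: c23 cA; clear; lia.
rewrite -(@eq_of_sub_dim _ _ (B X3 :&: B X1) (B X1 :&: B X2))%VS ?capvSl //.
  by rewrite subv_cap capvSr E1 -E2 capvSr.
by rewrite (capvC (B X3)); move: c12 c13; clear; lia.
Qed.

(** For [X3] inside [X1 + X2], an auxiliary [X4] of the star outside that span
    has the same intersection with [B X1] as [B X2], and [X3] is outside
    [X1 + X4]. *)
Lemma star_cap S X1 X2 X3 : (d.+2 < \dim {:V})%N -> \dim S = d ->
  \dim X1 = d.+1 -> \dim X2 = d.+1 -> \dim X3 = d.+1 ->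
  (S <= X1)%VS -> (S <= X2)%VS -> (S <= X3)%VS ->
  X1 != X2 -> (B X1 :&: B X2 <= B X3)%VS.
Proof.
move=> dV dS d1 d2 d3 S1 S2 S3 X12.
have [X312|] := boolP (X3 <= X1 + X2)%VS; last exact: (star_cap_out dS d1 d2 d3).
have [->|X31] := eqVneq X3 X1; first exact: capvSl.
have dS' : (d <= \dim S)%N by rewrite dS.
have d12 := addv_adjacent d1 d2 dS' S1 S2 X12.
have /subvPn[v _ vN] : ~~ (fullv <= X1 + X2)%VS.
  by apply/negP => /dimvS; rewrite d12 leqNgt dV.
have vS : ~~ (<[v]> <= S)%VS.
  apply: contra vN => vS; rewrite memvE; apply: subv_trans vS _.
  exact: subv_trans S1 (addvSl _ _).
have [X4 /andP[X4l X4u] d4] : exists2 X4, (S + <[v]> <= X4 <= fullv)%VS & \dim X4 = d.+1.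
  apply: subspace_between; first exact: subvf.
  by rewrite -dS in dV *; rewrite dim_addv_line ltnW // ltnW.
have /andP[S4 v4] : ((S <= X4) && (<[v]> <= X4))%VS by rewrite -subv_add.
have X412 : ~~ (X4 <= X1 + X2)%VS.
  by apply: contra vN => X4s; rewrite memvE (subv_trans v4).
have X14 : X1 != X4 by apply: contraNneq X412 => <-; rewrite addvSl.
have d14 := addv_adjacent d1 d4 dS' S1 S4 X14.
have P4 := star_cap_out dS d1 d2 d4 S1 S2 S4 X12 X412.
have X3N : ~~ (X3 <= X1 + X4)%VS.
  apply: contra X31 => X314.
  have X1c : (X1 = (X1 + X2) :&: (X1 + X4))%VS.
    apply: eq_of_sub_dim; first by rewrite subv_cap !addvSl.
    have X124 : (X1 + X2)%VS != (X1 + X4)%VS.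
      by apply: contraNneq X412 => ->; rewrite addvSr.
    have := addv_adjacent d12 d14 _ (addvSl _ _) (addvSl _ _) X124.
    rewrite d1 => /(_ (leqnn _)) => d124.
    move: (dimv_sum_cap (X1 + X2) (X1 + X4)) d12 d14 d124 d1; clear; lia.
  apply/eqP/eq_of_sub_dim; last by rewrite d1 d3.
  by rewrite [X in (_ <= X)%VS]X1c subv_cap X312.
apply: subv_trans (star_cap_out dS d1 d4 d3 S1 S4 S3 X14 X3N).
by rewrite subv_cap capvSl.
Qed.

(** By [star_cap] the intersection of two images does not depend on the two [X]
    chosen above [S], so it may serve as [g S]. *)
Lemma star_center : (d.+2 < \dim {:V})%N ->
  exists g, rank_preserving d g /\ incident d d.+1 g B.
Proof.
move=> dV.
suff /choice[g gP] : forall S, exists P, \dim S = d -> \dim P = d /\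
    forall X, \dim X = d.+1 -> (S <= X)%VS -> (P <= B X)%VS.
  by exists g; split=> [S dS|S X dS dX SX]; [case: (gP S dS)|case: (gP S dS) => _; apply].
move=> S; have [dS|] := eqVneq (\dim S) d; last by move=> /eqP NdS; exists S => /NdS.
have [X1 /andP[S1 _] d1] : exists2 X1, (S <= X1 <= fullv)%VS & \dim X1 = d.+1.
  by apply: subspace_between; rewrite ?subvf // dS leqnSn ltnW // ltnW.
have /subvPn[v _ vN] : ~~ (fullv <= X1)%VS.
  by apply/negP => /dimvS; rewrite d1 leqNgt ltnW.
have [X2 /andP[X2l X2u] d2] : exists2 X2, (S + <[v]> <= X2 <= fullv)%VS & \dim X2 = d.+1.
  apply: subspace_between; first exact: subvf.
  by rewrite -dS in dV *; rewrite dim_addv_line ltnW // ltnW.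
have /andP[S2 v2] : ((S <= X2) && (<[v]> <= X2))%VS by rewrite -subv_add.
have X12 : X1 != X2 by apply: contraNneq vN => ->; rewrite memvE.
have dS' : (d <= \dim S)%N by rewrite dS.
have d12 := addv_adjacent d1 d2 dS' S1 S2 X12.
exists (B X1 :&: B X2)%VS => _; split=> [|X dX SX]; last exact: (star_cap dV dS d1 d2 dX).
by have := dim_image_cap A_rank B_rank BA B_inj d1 d2 X12 d12 (addvSl _ _) (addvSr _ _); clear; lia.
Qed.

End Star.
End SubspaceMaps.

(** * From k-subspaces down to lines *)

Section GrassmannianMaps.
Variables (C : numClosedFieldType) (H : vectType C).
Variable form : {dot H for Num.conj}.
Variables (k : nat) (F : {vspace H} -> {vspace H}).
Implicit Types (S T W X Y Z P Q R D : {vspace H}).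
Local Notation perp := (orthov form).
Local Notation n := (\dim {:H}).

Hypotheses (k_gt0 : (0 < k)%N) (k_small : (2 * k < n)%N).
Hypothesis F_rank : rank_preserving k F.
Hypothesis F_orth : forall X Y, \dim X = k -> \dim Y = k ->
  (F X <= perp (F Y))%VS = (X <= perp Y)%VS.

Lemma F_injective X Y : \dim X = k -> \dim Y = k -> F X = F Y -> X = Y.
Proof.
move=> dX dY FXY; apply/eq_of_sub_dim; last by rewrite dX dY.
apply/negPn/negP => XY.
have [|Z [dZ ZY /negP[]]] := @orthogonal_separation _ _ form X Y k k_gt0 _ XY.
  by have := dim_orthov form Y; rewrite dY; move: k_small; clear; lia.
by rewrite -F_orth // FXY F_orth // orthov_sym.
Qed.

(** [D] accumulates images: when [Z0] grows to [Z] by one dimension, some [X]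
    in [Z] is separated from [Z0] by a [Y] orthogonal to [Z0], and [F Y] then
    separates [F X] from the space built for [Z0]. *)
Lemma chain_bound d Z : (k <= d <= n - k)%N -> \dim Z = d ->
  exists2 D, (d <= \dim D)%N &
    forall Y, \dim Y = k -> (Y <= perp Z)%VS -> (F Y <= perp D)%VS.
Proof.
elim: d Z => [|d IHd] Z /andP[kd dn] dZ.
  by move: k_gt0; rewrite ltnNge kd.
have [kd'|dk] := leqP k d; last first.
  have dZk : \dim Z = k by move: kd dk dZ; clear; lia.
  by exists (F Z); [rewrite F_rank // -dZk dZ | move=> Y dY; rewrite F_orth].
have [Z0 /andP[_ Z0Z] dZ0] : exists2 Z0, (0 <= Z0 <= Z)%VS & \dim Z0 = d.
  by apply: subspace_between; rewrite ?sub0v // dimv0 dZ leqnSn.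
have [|D0 dD0 D0P] := IHd Z0 _ dZ0; first by rewrite kd' ltnW.
have /subvPn[x xZ xZ0] : ~~ (Z <= Z0)%VS.
  by apply/negP => /dimvS; rewrite dZ dZ0 ltnn.
have [X /andP[xX XZ] dX] : exists2 X, (<[x]> <= X <= Z)%VS & \dim X = k.
  by apply: subspace_through; rewrite ?k_gt0 ?dZ.
have XZ0 : ~~ (X <= Z0)%VS by apply: contra xZ0; rewrite memvE; apply: subv_trans.
have [|Y [dY YZ0 XY]] := @orthogonal_separation _ _ form X Z0 k k_gt0 _ XZ0.
  by have := dim_orthov form Z0; rewrite dZ0; move: dn; clear; lia.
exists (D0 + F X)%VS.
  apply: leq_ltn_trans dD0 _; rewrite ltn_neqAle dimvS ?addvSl // andbT.
  apply: contra XY => /eqP dDX; rewrite -F_orth //.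
  apply: subv_trans (addvSr D0 _) _.
  by rewrite -(eq_of_sub_dim (addvSl D0 (F X))) ?dDX // orthov_sym D0P.
move=> Y' dY' Y'Z; rewrite orthovD D0P //= ?F_orth //.
  by apply: subv_trans Y'Z (orthov_anti _ XZ).
by apply: subv_trans Y'Z (orthov_anti _ Z0Z).
Qed.

(** Apply [chain_bound] to the orthocomplement of [W], and take [A] to be the
    orthocomplement of the space so obtained. *)
Lemma hull_exists W : \dim W = k.+1 ->
  exists2 A, \dim A = k.+1 &
    forall X, \dim X = k -> (X <= W)%VS -> (F X <= A)%VS.
Proof.
move=> dW; have dWp := dim_orthov form W; rewrite dW in dWp.
have [|D dD DP] := @chain_bound _ (perp W) _ erefl.
  by move: dWp k_gt0 k_small; clear; lia.
have FW X : \dim X = k -> (X <= W)%VS -> (F X <= perp D)%VS.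
  by move=> dX XW; apply: DP; rewrite // orthovK.
exists (perp D) => //.
have [X /andP[_ XW] dX] : exists2 X, (0 <= X <= W)%VS & \dim X = k.
  by apply: subspace_between; rewrite ?sub0v // dimv0 dW leqnSn.
have /subvPn[y yW yX] : ~~ (W <= X)%VS.
  by apply/negP => /dimvS; rewrite dW dX ltnn.
have [Y /andP[yY YW] dY] : exists2 Y, (<[y]> <= Y <= W)%VS & \dim Y = k.
  by apply: subspace_through; rewrite ?k_gt0 ?dW ?leqnSn.
apply/eqP; rewrite eqn_leq; apply/andP; split.
  by have := dim_orthov form D; move: dD dWp; clear; lia.
rewrite -(F_rank dX) ltn_neqAle dimvS ?FW // andbT.
apply: contra yX => /eqP dXD.
have FXE := eq_of_sub_dim (FW X dX XW) (eq_leq (esym dXD)).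
rewrite memvE; apply: subv_trans yY _.
rewrite (@F_injective Y X) ?subvv //.
by apply: eq_of_sub_dim; rewrite ?F_rank // FXE FW.
Qed.

(** [A] is injective because [A W2] is spanned by two images [F S] and [F T]
    with [S] and [T] in [W2], so that whatever is orthogonal to both is
    orthogonal to [A W2]. *)
Lemma hull_map : exists A, [/\ rank_preserving k.+1 A, incident k k.+1 F A &
  adjacent_injective k.+1 A].
Proof.
have /choice[A AP] : forall W, exists A, \dim W = k.+1 -> \dim A = k.+1 /\
    forall X, \dim X = k -> (X <= W)%VS -> (F X <= A)%VS.
  move=> W; have [/hull_exists[A dA AW]|/eqP NdW] := eqVneq (\dim W) k.+1.
    by exists A.
  by exists W => /NdW.
have A_rank : rank_preserving k.+1 A by move=> W /AP[].
have FA : incident k k.+1 F A by move=> X W dX dW; apply: (AP W dW).2.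
exists A; split=> // W1 W2 d1 d2 d12 A12.
have /subvPn[x x1 x2] : ~~ (W1 <= W2)%VS.
  by apply/negP => /addv_idPr W12; move: d12; rewrite W12 d2; clear; lia.
have [X /andP[xX XW1] dX] : exists2 X, (<[x]> <= X <= W1)%VS & \dim X = k.
  by apply: subspace_through; rewrite ?k_gt0 ?d1 ?leqnSn.
have XW2 : ~~ (X <= W2)%VS by apply: contra x2; rewrite memvE; apply: subv_trans.
have [|Y [dY YW2 XY]] := @orthogonal_separation _ _ form X W2 k k_gt0 _ XW2.
  by have := dim_orthov form W2; rewrite d2; move: k_gt0 k_small; clear; lia.
have F_adj : adjacent_injective k F.
  by move=> S T dS dT dST /(F_injective dS dT) ST; move: dST; rewrite ST addvv dT; clear; lia.
have [S /andP[_ SW2] dS] : exists2 S, (0 <= S <= W2)%VS & \dim S = k.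
  by apply: subspace_between; rewrite ?sub0v // dimv0 d2 leqnSn.
have /subvPn[t tW2 tS] : ~~ (W2 <= S)%VS.
  by apply/negP => /dimvS; rewrite d2 dS ltnn.
have [T /andP[tT TW2] dT] : exists2 T, (<[t]> <= T <= W2)%VS & \dim T = k.
  by apply: subspace_through; rewrite ?k_gt0 ?d2 ?leqnSn.
have ST : S != T by apply: contraNneq tS => ->; rewrite memvE.
have AE := image_span A_rank F_rank FA F_adj dS dT ST d2 SW2 TW2.
have YA : (F Y <= perp (A W2))%VS.
  rewrite -AE orthovD !F_orth //.
  by rewrite !(subv_trans YW2 (orthov_anti _ _)).
move/negP: XY; apply; rewrite -F_orth // orthov_sym.
by apply: subv_trans YA (orthov_anti _ _); rewrite -A12 FA.
Qed.

Lemma F_adjacent_cap X Y : \dim X = k -> \dim Y = k -> (\dim (X + Y) <= k.+1)%N ->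
  (k <= (\dim (F X :&: F Y)).+1)%N.
Proof.
move=> dX dY dXY; have [A [A_rank FA _]] := hull_map.
have [W /andP[XYW _] dW] : exists2 W, (X + Y <= W <= fullv)%VS & \dim W = k.+1.
  by apply: subspace_between; rewrite ?subvf // dXY; move: k_gt0 k_small; clear; lia.
have : (\dim (F X + F Y) <= k.+1)%N.
  rewrite -(A_rank _ dW) dimvS // subv_add !FA //.
    exact: subv_trans (addvSr _ _) XYW.
  exact: subv_trans (addvSl _ _) XYW.
by have := dimv_sum_cap (F X) (F Y); rewrite !F_rank //; clear; lia.
Qed.

(** Induction on the distance [i] from [X] to the star of [R]: each step to an
    adjacent subspace costs at most one dimension of the intersection with
    [P]. *)
Lemma meets_common_part R P : (\dim R <= k)%N ->
  (forall X, \dim X = k -> (R <= X)%VS -> (P <= F X)%VS) ->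
  forall i X, \dim X = k -> (\dim (X + R) <= k + i)%N ->
    (\dim P <= \dim (F X :&: P) + i)%N.
Proof.
move=> dR RP; elim=> [|i IHi] X dX dXR.
  rewrite addn0 (capv_idPr (RP X dX _)) //.
  rewrite [X in (_ <= X)%VS](@eq_of_sub_dim _ _ X (X + R)%VS) ?addvSl ?addvSr //.
  by rewrite dX -(addn0 k).
have [RX|] := boolP (R <= X)%VS.
  by rewrite (capv_idPr (RP X dX RX)) leq_addr.
move=> RX; have /subvPn[r rR rX] := RX.
(* exchange one dimension of [X] off [X :&: R] for the vector [r] of [R] *)
have [X0 /andP[X0l X0X] dX0] : exists2 X0, (X :&: R <= X0 <= X)%VS & \dim X0 = k.-1.
  apply: subspace_between; rewrite ?capvSl // dX leq_pred andbT.
  rewrite -ltnS prednK // -dX ltn_neqAle dimvS ?capvSl // andbT.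
  apply: contra RX => /eqP dXR'.
  have XR : (X <= R)%VS.
    by apply/capv_idPl/eq_of_sub_dim; rewrite ?capvSl // dXR'.
  by rewrite (eq_of_sub_dim XR) ?dX.
have dX' : \dim (X0 + <[r]>) = k.
  have r0 : r != 0 by apply: contraNneq rX => ->; rewrite mem0v.
  rewrite dimv_disjoint_sum ?dX0 ?dim_vline ?r0 ?addn1 ?prednK //.
  apply/eqP; rewrite -subv0; apply/subvP => x /memv_capP[xX /vlineP[a xE]].
  move: xX; rewrite memv0 xE; have [->|a0] := eqVneq a 0; first by rewrite scale0r.
  move=> /(subvP X0X)/(memvZ a^-1); rewrite scalerK // (negPf rX) //.
have X'R : (X0 + <[r]> + R = X0 + R)%VS.
  by rewrite -addvA; congr (_ + _)%VS; apply/addv_idPr; rewrite -memvE.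
have dX'R : (\dim (X0 + <[r]> + R) <= k + i)%N.
  have : (X :&: R <= X0 :&: R)%VS by rewrite subv_cap X0l capvSr.
  move=> /dimvS; rewrite X'R.
  move: (dimv_sum_cap X R) (dimv_sum_cap X0 R) dXR k_gt0; rewrite dX dX0.
  by clear; lia.
have FXX' : (k <= (\dim (F X :&: F (X0 + <[r]>))).+1)%N.
  apply: F_adjacent_cap => //; rewrite addvA (addv_idPl X0X) -dX.
  exact: dim_addv_line.
have := IHi _ dX' dX'R.
have := dimv_sum_cap (F X :&: F (X0 + <[r]>)) (F (X0 + <[r]>) :&: P).
have : (\dim (F X :&: F (X0 + <[r]>) + F (X0 + <[r]>) :&: P) <= k)%N.
  by rewrite -(F_rank dX') dimvS // subv_add capvSr capvSl.
have : (\dim (F X :&: F (X0 + <[r]>) :&: (F (X0 + <[r]>) :&: P)) <= \dim (F X :&: P))%N.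
  apply: dimvS; rewrite subv_cap (subv_trans (capvSl _ _)) ?capvSl //=.
  by rewrite (subv_trans (capvSr _ _)) ?capvSr.
by move: FXX'; clear; lia.
Qed.

(** With [dim R] as the largest possible distance, [meets_common_part] makes
    every [F X] meet [P]; a subspace orthogonal to one containing [R]
    contradicts this. *)
Lemma no_common_part R P : (\dim R < \dim P)%N -> (\dim R <= k)%N ->
  ~ (forall X, \dim X = k -> (R <= X)%VS -> (P <= F X)%VS).
Proof.
move=> dRP dR RP.
have [X1 /andP[RX1 _] d1] : exists2 X, (R <= X <= fullv)%VS & \dim X = k.
  by apply: subspace_between; rewrite ?subvf // dR; move: k_small; clear; lia.
have [X2 /andP[_ X2X1] d2] : exists2 X, (0 <= X <= perp X1)%VS & \dim X = k.
  apply: subspace_between; rewrite ?sub0v // dimv0 /=.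
  by move: (dim_orthov form X1) k_small; rewrite d1; clear; lia.
have d2R : (\dim (X2 + R) <= k + \dim R)%N.
  by rewrite -{1}d2; case: (dimv_add_leqif X2 R).
have := meets_common_part dR RP d2 d2R.
rewrite (@orthov_disjoint _ _ form (F X2) (F X1) (F X2 :&: P)) ?F_orth ?capvSl //.
  by rewrite dimv0 add0n leqNgt dRP.
by apply: subv_trans (capvSr _ _) _; apply: RP.
Qed.

Section DescentStep.
Variables (d : nat) (B g : {vspace H} -> {vspace H}).
Hypothesis d_lt_k : (d < k)%N.
Hypotheses (B_rank : rank_preserving d.+1 B) (g_rank : rank_preserving d g).
Hypotheses (gB : incident d d.+1 g B) (gF : incident d k g F).
Hypothesis B_adj : adjacent_injective d.+1 B.

(** A coincidence [g S = g T] of adjacent spaces spreads to the whole star of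
    [R = S :&: T]: a further [Q] of the star has [g Q] in the intersection of
    [B (S + Q)] and [B (T + Q)], which is [g S] by dimension.  Then every [F X]
    with [R <= X] contains [g S], against [no_common_part]. *)
Lemma descent_injective : adjacent_injective d g.
Proof.
move=> S T dS dT dST gST.
pose R := (S :&: T)%VS.
have dR : (\dim R).+1 = d.
  by move: (dimv_sum_cap S T); rewrite dS dT dST -/R; clear; lia.
have Rd : (d.-1 <= \dim R)%N by rewrite -dR.
have d_gt0 : (0 < d)%N by rewrite -dR.
have dB X Y : \dim X = d.+1 -> \dim Y = d.+1 -> \dim (X + Y) = d.+2 ->
    (\dim (B X :&: B Y) <= d)%N.
  move=> dX dY dXY; rewrite leqNgt; apply/negP => dBXY.
  have BX : (B X :&: B Y = B X)%VS by apply: eq_of_sub_dim; rewrite ?capvSl ?B_rank.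
  have BY : (B X :&: B Y = B Y)%VS by apply: eq_of_sub_dim; rewrite ?capvSr ?B_rank.
  by apply: B_adj dXY _; rewrite // -BX BY.
have addR X Y : \dim X = d -> \dim Y = d -> (R <= X)%VS -> (R <= Y)%VS -> X != Y ->
    \dim (X + Y) = d.+1.
  move=> dX dY RX RY XY; have := @addv_adjacent _ _ d.-1 X Y R.
  by rewrite prednK //; apply.
(* stated for any coinciding pair of the star, as it is used for two pairs *)
have out S' T' Q : \dim S' = d -> \dim T' = d -> \dim Q = d -> S' != T' ->
    (R <= S')%VS -> (R <= T')%VS -> (R <= Q)%VS -> g S' = g T' ->
    ~~ (Q <= S' + T')%VS -> g Q = g S'.
  move=> dS' dT' dQ ST' RS' RT' RQ gST' QST.
  have SQ : S' != Q by apply: contraNneq QST => <-; rewrite addvSl.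
  have TQ : T' != Q by apply: contraNneq QST => <-; rewrite addvSr.
  have dST' := addR _ _ dS' dT' RS' RT' ST'.
  have dSQ := addR _ _ dS' dQ RS' RQ SQ.
  have dTQ := addR _ _ dT' dQ RT' RQ TQ.
  have STQ : (S' + Q != T' + Q)%VS.
    apply: contraNneq QST => STQ.
    have -> : (S' + T' = S' + Q)%VS; last exact: addvSr.
    apply: eq_of_sub_dim; last by rewrite dST' dSQ.
    by rewrite subv_add addvSl STQ addvSl.
  have dSTQ := addv_adjacent dSQ dTQ (eq_leq (esym dQ)) (addvSr _ _) (addvSr _ _) STQ.
  have capE X : \dim X = d -> (X <= B (S' + Q) :&: B (T' + Q))%VS ->
      X = (B (S' + Q) :&: B (T' + Q))%VS.
    by move=> dX XB; apply: eq_of_sub_dim => //; rewrite dX; apply: dB.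
  rewrite (capE (g Q)) ?g_rank //; last by rewrite subv_cap !gB ?addvSr.
  rewrite (capE (g S')) ?g_rank // subv_cap gB ?addvSl //=.
  by rewrite gST' gB ?addvSl.
have ST : S != T by apply/eqP => ST; move: dST; rewrite ST addvv dT; clear; lia.
have allQ Q : \dim Q = d -> (R <= Q)%VS -> g Q = g S.
  move=> dQ RQ; have [QST|] := boolP (Q <= S + T)%VS; last first.
    by apply: (out S T Q); rewrite ?capvSl ?capvSr.
  have [->//|QS] := eqVneq Q S.
  (* [Q] lies in [S + T]: pass through some [Q0] outside [S + T] *)
  have /subvPn[v _ vN] : ~~ (fullv <= S + T)%VS.
    by apply/negP => /dimvS; rewrite dST; move: d_lt_k k_small; clear; lia.
  have [Q0 /andP[Q0l _] dQ0] : exists2 Q0, (R + <[v]> <= Q0 <= fullv)%VS & \dim Q0 = d.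
    apply: subspace_between; rewrite ?subvf // -{1}dR dim_addv_line.
    by move: d_lt_k k_small; clear; lia.
  have /andP[RQ0 vQ0] : ((R <= Q0) && (<[v]> <= Q0))%VS by rewrite -subv_add.
  have Q0ST : ~~ (Q0 <= S + T)%VS.
    by apply: contra vN => Q0s; rewrite memvE (subv_trans vQ0).
  have gQ0 : g Q0 = g S by apply: (out S T Q0); rewrite ?capvSl ?capvSr.
  have SQ0 : S != Q0 by apply: contraNneq Q0ST => <-; rewrite addvSl.
  apply: (out S Q0 Q); rewrite ?capvSl //.
  apply: contra QS => QSQ0; apply/eqP/eq_of_sub_dim; last by rewrite dS dQ.
  have -> : S = ((S + T) :&: (S + Q0))%VS.
    apply: eq_of_sub_dim; first by rewrite subv_cap !addvSl.
    have dSQ0 := addR _ _ dS dQ0 (capvSl _ _) RQ0 SQ0.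
    have STQ0 : (S + T != S + Q0)%VS by apply: contraNneq Q0ST => ->; rewrite addvSr.
    have := addv_adjacent dST dSQ0 (eq_leq (esym dS)) (addvSl _ _) (addvSl _ _) STQ0.
    by move: (dimv_sum_cap (S + T) (S + Q0)); rewrite dST dSQ0 dS; clear; lia.
  by rewrite subv_cap QST.
apply: (@no_common_part R (g S)).
- by rewrite g_rank // -dR.
- by move: dR d_lt_k; clear; lia.
move=> X dX RX.
have [Q /andP[RQ QX] dQ] : exists2 Q, (R <= Q <= X)%VS & \dim Q = d.
  by apply: subspace_between; rewrite // dX -{1}dR leqnSn ltnW.
by rewrite -(allQ Q) //; apply: gF.
Qed.

End DescentStep.

Lemma descent d : (0 < d <= k)%N -> exists A B,
  [/\ rank_preserving d.+1 A, rank_preserving d B, incident d d.+1 B A,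
      incident d k B F & adjacent_injective d.+1 A /\ adjacent_injective d B].
Proof.
move=> /andP[d_gt0 dk]; rewrite -(subKn dk).
have : (k - d < k)%N by rewrite ltn_subrL d_gt0.
elim: (k - d)%N => [|m IHm] mk.
  rewrite subn0; have [A [A_rank FA A_adj]] := hull_map.
  exists A, F; split=> // [X Y dX dY XY|].
    by rewrite (eq_of_sub_dim XY) ?subvv // dX dY.
  split=> // X Y dX dY dXY /(F_injective dX dY) XY.
  by move: dXY; rewrite XY addvv dY; clear; lia.
have [A [B []]] := IHm (ltnW mk).
have -> : (k - m)%N = (k - m.+1).+1 by rewrite subnSK // ltnW.
set e := (k - m.+1)%N => A_rank B_rank BA BF [A_adj B_adj].
have ek : (e < k)%N by rewrite /e; move: mk; clear; lia.
have [|g [g_rank gB]] := star_center A_rank B_rank BA A_adj B_adj.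
  by move: ek k_small; clear; lia.
have gF : incident e k g F.
  move=> S X dS dX SX.
  have [Q /andP[SQ QX] dQ] : exists2 Q, (S <= Q <= X)%VS & \dim Q = e.+1.
    by apply: subspace_between; rewrite // dX dS leqnSn.
  by apply: subv_trans (gB S Q dS dQ SQ) (BF Q X dQ dX QX).
exists B, g; split=> //; split=> //.
exact: (descent_injective ek B_rank g_rank gB gF B_adj).
Qed.

Lemma line_map_exists : exists L,
  [/\ rank_preserving 1 L, incident 1 k L F,
   (forall p q, \dim p = 1%N -> \dim q = 1%N -> L p = L q -> p = q) &
   (forall p q, \dim p = 1%N -> \dim q = 1%N ->
      (p <= perp q)%VS -> (L p <= perp (L q))%VS)].
Proof.
have [|_ [L [_ L_rank _ LF [_ L_adj]]]] := @descent 1; first by rewrite k_gt0.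
exists L; split=> // p q dp dq.
  move=> Lpq; apply/eqP/negPn/negP => pq; apply: L_adj Lpq => //.
  by have := @addv_adjacent _ _ 0 p q 0; rewrite !sub0v; apply.
move=> pq.
have [X /andP[pX Xq] dX] : exists2 X, (p <= X <= perp q)%VS & \dim X = k.
  apply: subspace_between; rewrite // dp k_gt0 /=.
  by move: (dim_orthov form q) k_small; rewrite dq; clear; lia.
have [Y /andP[qY YX] dY] : exists2 Y, (q <= Y <= perp X)%VS & \dim Y = k.
  apply: subspace_between; first by rewrite orthov_sym.
  by move: (dim_orthov form X) k_small; rewrite dX dq k_gt0; clear; lia.
apply: subv_trans (LF p X dp dX pX) _.
apply: subv_trans (orthov_anti form (LF q Y dq dY qY)).
by rewrite F_orth // orthov_sym.
Qed.

End GrassmannianMaps.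

(** * The functional equation and endomorphisms of the complex field *)

Section FunctionalEquation.
Variables (C : numClosedFieldType).

(** Orthogonality of the vectors with coordinates (1, x, y) and (1, s, t) is
    carried over by the coordinatewise maps [a] and [b]. *)
Definition line_equation (a b : C -> C) := forall x s y t : C,
  1 + x * s^* + y * t^* = 0 -> 1 + a x * (a s)^* + b y * (b t)^* = 0.

Lemma line_equationC a b : line_equation a b -> line_equation b a.
Proof.
move=> ab x s y t E; rewrite -addrA (addrC (b x * _)) addrA.
by apply: ab; rewrite -E -!addrA (addrC (x * _)).
Qed.

Section OneCoordinate.
Variables a b : C -> C.
Hypotheses (ab : line_equation a b) (b0 : b 0 = 0).

Let a1N1 : a 1 * (a (-1))^* = -1.
Proof.
have := @ab 1 (-1) 0 0; rewrite rmorphN rmorph1 b0 !mul0r !mul1r !addr0 subrr.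
by move=> /(_ erefl)/eqP; rewrite addrC addr_eq0 => /eqP.
Qed.

Lemma line_equation_neq0 : a 1 != 0.
Proof. by apply: contra_eq_neq a1N1 => ->; rewrite mul0r eq_sym oppr_eq0 oner_eq0. Qed.

(* The left-hand side depends only on the product of [x] and the conjugate of
   [s], because that product fixes the remaining summand of the equation. *)
Let prodE x s : a x * (a s)^* = a 1 * (a (x^* * s))^*.
Proof.
have E y z : a y * (a z)^* = - 1 - b 1 * (b (- 1 - y * z^*)^*)^*.
  have := @ab y z 1 (- 1 - y * z^*)^*; rewrite conjCK mul1r.
  have -> : 1 + y * z^* + (- 1 - y * z^*) = 0 by ring.
  by move=> /(_ erefl) Eab; apply/eqP; rewrite -subr_eq0 -Eab; apply/eqP; ring.
by rewrite !E rmorphM /= conjCK mul1r.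
Qed.

(* [a (-1)] and [a 1] have the same square; equality would give
   [|a 1|^2 = -1] *)
Let aN1 : a (-1) = - a 1.
Proof.
have c0 : (a 1)^* != 0 by rewrite conjC_eq0 line_equation_neq0.
have E1 : a (-1) * (a (-1))^* = a 1 * (a 1)^*.
  by rewrite prodE rmorphN1 mulN1r opprK.
have E2 : a (-1) * (a 1)^* = a 1 * (a (-1))^* by rewrite prodE rmorphN1 mulN1r.
have : (a (-1) - a 1) * (a (-1) + a 1) = 0.
  apply: (mulIf c0); rewrite mul0r.
  have -> : (a (-1) - a 1) * (a (-1) + a 1) * (a 1)^* =
     a (-1) * (a (-1) * (a 1)^*) - a 1 * (a 1 * (a 1)^*) by ring.
  by rewrite E2 -E1; ring.
move=> /eqP; rewrite mulf_eq0 subr_eq0 addr_eq0 => /orP[/eqP aE|/eqP //].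
have := a1N1; rewrite aE => /eqP; rewrite eq_sym => /eqP N1.
have := mul_conjC_ge0 (a 1); rewrite -N1 oppr_ge0 => /(lt_le_trans ltr01).
by rewrite ltxx.
Qed.

Lemma line_equation_norm1 : a 1 * (a 1)^* = 1.
Proof. by apply/oppr_inj; rewrite -a1N1 aN1 rmorphN mulrN. Qed.

Definition ratio1 x := a x / a 1.

Lemma ratio1_1 : ratio1 1 = 1. Proof. by rewrite /ratio1 divff ?line_equation_neq0. Qed.

Lemma ratio1_conj x : ratio1 x^* = (ratio1 x)^*.
Proof.
rewrite /ratio1 fmorph_div.
have := prodE x^* 1; rewrite conjCK mulr1 => E.
apply: (mulIf (_ : (a 1)^* != 0)); first by rewrite conjC_eq0 line_equation_neq0.
rewrite mulrAC E divfK ?conjC_eq0 ?line_equation_neq0 //.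
by rewrite mulrAC divff ?line_equation_neq0 // mul1r.
Qed.

Lemma ratio1_prod x s : a x * (a s)^* = ratio1 (x * s^*).
Proof.
rewrite prodE; have := ratio1_conj (x^* * s); rewrite rmorphM /= conjCK => ->.
have c0 : (a 1)^* != 0 by rewrite conjC_eq0 line_equation_neq0.
rewrite /ratio1 fmorph_div mulrC; congr (_ * _).
by apply: (mulIf c0); rewrite mulVf // line_equation_norm1.
Qed.

Lemma ratio1M x y : ratio1 (x * y) = ratio1 x * ratio1 y.
Proof.
rewrite -{1}(conjCK y) -ratio1_prod; have := ratio1_conj y^*; rewrite conjCK => ->.
rewrite /ratio1 fmorph_div mulrACA -invfM line_equation_norm1 invr1 mulr1.
by [].
Qed.

End OneCoordinate.

Section TwoCoordinates.
Variables a b : C -> C.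
Hypotheses (ab : line_equation a b) (a0 : a 0 = 0) (b0 : b 0 = 0).
Let ba := line_equationC ab.

Let add1 a' b' : line_equation a' b' -> a' 0 = 0 -> b' 0 = 0 ->
  forall p, ratio1 b' (1 + p) = 1 + ratio1 a' p.
Proof.
move=> ab' a'0 b'0 p; have ba' := line_equationC ab'.
have bN : ratio1 b' (- (1 + p)) = - ratio1 b' (1 + p).
  rewrite -mulN1r (ratio1M ba') // -(mulN1r (ratio1 b' (1 + p))).
  congr (_ * _); have := ratio1_prod ba' a'0 1 (-1).
  rewrite mul1r rmorphN1 => <-.
  have := @ba' 1 (-1) 0 0; rewrite rmorphN1 a'0 !mul0r !mul1r !addr0 subrr.
  by move=> /(_ erefl)/eqP; rewrite addrC addr_eq0 => /eqP.
have := @ab' p 1 (- (1 + p)) 1; rewrite rmorph1 !mulr1.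
rewrite (ratio1_prod ab') // (ratio1_prod ba') // rmorph1 !mulr1 bN subrr => /(_ erefl)/eqP.
by rewrite subr_eq0 eq_sym => /eqP.
Qed.

(** Normalised, the equation reads [ratio1 b (1 + p) = 1 + ratio1 a p], and
    symmetrically; expanding [ratio1 b (2 * (1 + p))] in two ways separates the two
    functions. *)
Lemma ratio1_eq : ratio1 a =1 ratio1 b.
Proof.
move=> p; have [A B] := (add1 ab a0 b0, add1 ba b0 a0).
have a2 : ratio1 a (1 + 1) = 1 + 1 by rewrite B (ratio1_1 ba).
have b2 : ratio1 b (1 + 1) = 1 + 1 by rewrite A (ratio1_1 ab).
have E1 : ratio1 b ((1 + 1) * (1 + p)) = (1 + 1) * (1 + ratio1 a p).
  by rewrite (ratio1M ba) // b2 A.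
have E2 : ratio1 b ((1 + 1) * (1 + p)) = (1 + 1) * (1 + ratio1 b p).
  have -> : (1 + 1) * (1 + p) = 1 + (1 + (1 + 1) * p) by ring.
  by rewrite A B (ratio1M ba) // b2; ring.
have two_neq0 : (1 + 1 : C) != 0 by rewrite (_ : 1 + 1 = 2%:R) ?pnatr_eq0.
by move: E2; rewrite E1 => /(mulfI two_neq0)/addrI.
Qed.

(** Additivity reduces by multiplicativity to the case [x = 1]. *)
Lemma ratio1D x y : ratio1 a (x + y) = ratio1 a x + ratio1 a y.
Proof.
have add p : ratio1 a (1 + p) = 1 + ratio1 a p.
  by rewrite (add1 ba b0 a0) -ratio1_eq.
have [->|x0] := eqVneq x 0; first by rewrite /ratio1 a0 mul0r !add0r.
have -> : x + y = x * (1 + y / x) by rewrite mulrDr mulr1 mulrC divfK.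
by rewrite (ratio1M ab) // add mulrDr mulr1 -(ratio1M ab) // mulrC divfK.
Qed.

Lemma line_equation_endomorphism : exists s : {rmorphism C -> C},
  [/\ forall x, a x = a 1 * s x, forall x, b x = b 1 * s x &
      forall x, s x^* = (s x)^*].
Proof.
have a1 := line_equation_neq0 ab b0; have b1 := line_equation_neq0 ba a0.
have s0 : ratio1 a 0 = 0 by rewrite /ratio1 a0 mul0r.
have sM : monoid_morphism (ratio1 a).
  by split; [exact: (ratio1_1 ab) | exact: (ratio1M ab)].
pose sAdd := GRing.isNmodMorphism.Build C C (ratio1 a) (conj s0 ratio1D).
pose sMul := GRing.isMonoidMorphism.Build C C (ratio1 a) sM.
pose s : {rmorphism C -> C} := HB.pack (ratio1 a) sAdd sMul.
exists s; split=> x /=.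
- by rewrite /ratio1 mulrC divfK.
- by rewrite ratio1_eq /ratio1 mulrC divfK.
- exact: (ratio1_conj ab).
Qed.

End TwoCoordinates.
End FunctionalEquation.

Section ComplexEndomorphisms.
Local Open Scope complex_scope.
Variables (R : realType) (s : {rmorphism R[i] -> R[i]}).
Hypothesis sJ : forall x, s (Num.conj x) = Num.conj (s x).

(** On the reals the endomorphism is real valued, since it commutes with
    conjugation, and monotone, since nonnegative reals are squares; it fixes the
    rationals, which are dense. *)
Lemma endomorphism_real (r : R) : s r%:C = r%:C.
Proof.
have sR q : exists p : R, s q%:C = p%:C.
  have : s q%:C \is Num.real.
    by rewrite CrealE -sJ (CrealP _) ?complex_real.
  by move=> /complex_realP.
have s_ge0 q : 0 <= q -> 0 <= s q%:C.
  move=> q0; rewrite -(sqr_sqrtr q0) rmorphXn /= rmorphXn /=.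
  by have [p ->] := sR (Num.sqrt q); rewrite -rmorphXn lecR sqr_ge0.
have s_mono q q' : q <= q' -> s q%:C <= s q'%:C.
  by move=> qq'; rewrite -subr_ge0 -rmorphB -rmorphB s_ge0 // subr_ge0.
have s_rat q : s (ratr q : R)%:C = (ratr q : R)%:C.
  by rewrite !fmorph_rat.
have [p sp] := sR r; rewrite sp; congr (_%:C); apply/eqP.
case: (ltgtP p r) => // /rat_in_itvoo[q]; rewrite in_itv /= => /andP[lo hi].
  have := s_mono _ _ (ltW hi); rewrite s_rat sp lecR.
  by move=> /(lt_le_trans lo); rewrite ltxx.
have := s_mono _ _ (ltW lo); rewrite s_rat sp lecR.
by move=> /(lt_le_trans hi); rewrite ltxx.
Qed.

Lemma endomorphism_id_or_conj : s =1 id \/ s =1 Num.conj.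
Proof.
have : (s 'i%C - 'i%C) * (s 'i%C + 'i%C) = 0.
  by rewrite -subr_sqr -rmorphXn /= sqr_i rmorphN1 subrr.
move=> /eqP; rewrite mulf_eq0 subr_eq0 addr_eq0 => /orP[]/eqP si; [left|right] => x.
  by rewrite [in LHS](complexE x) rmorphD rmorphM /= !endomorphism_real si -complexE.
rewrite [in LHS](complexE x) rmorphD rmorphM /= !endomorphism_real si.
case: x => a b; rewrite (_ : Num.conj _ = a -i* b) //=.
by apply/eqP; rewrite eq_complex /=; apply/andP; split; apply/eqP; ring.
Qed.

End ComplexEndomorphisms.

(** * Orthonormal bases *)

Section OrthonormalBases.
Variables (C : numClosedFieldType) (H : vectType C).
Variable form : {dot H for Num.conj}.
Local Notation n := (\dim {:H}).
Implicit Types (e : 'I_n -> H) (x y z : H).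

Definition orthonormal_basis e := forall i j, form (e i) (e j) = (i == j)%:R.

Lemma dotC x y : form x y = (form y x)^*.
Proof. by rewrite hermC mul1r. Qed.

Definition normalize x := (sqrtC (form x x))^-1 *: x.

Lemma normalize_scalar_neq0 x : x != 0 -> (sqrtC (form x x))^-1 != 0.
Proof. by rewrite invr_eq0 sqrt_dnorm_eq0. Qed.

Lemma dnorm_normalize x : x != 0 -> form (normalize x) (normalize x) = 1.
Proof.
move=> x0; rewrite dnormZ normrV ?unitfE ?sqrt_dnorm_eq0 //.
by rewrite ger0_norm ?sqrt_dnorm_ge0 // exprVn sqrtCK mulVf // dnorm_eq0.
Qed.

Section Expansion.
Variables (e : 'I_n -> H) (e_onb : orthonormal_basis e).

Lemma onb_coord (c : 'I_n -> C) j : form (\sum_i c i *: e i) (e j) = c j.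
Proof.
rewrite linear_sumlz (bigD1 j) //= linearZl_LR /= e_onb eqxx mulr1.
rewrite big1 ?addr0 // => i /negPf ij.
by rewrite linearZl_LR /= e_onb ij mulr0.
Qed.

Lemma onb_span : <<[tuple e i | i < n]>>%VS = fullv.
Proof.
have e_free : free [tuple e i | i < n].
  apply/freeP => c; under eq_bigr => i _ do rewrite -tnth_nth tnth_mktuple.
  by move=> c0 j; rewrite -(onb_coord c j) c0 linear0l.
apply: eq_of_sub_dim; first exact: subvf.
by move: e_free; rewrite /free size_tuple => /eqP ->.
Qed.

Lemma onb_ext x y : (forall i, form x (e i) = form y (e i)) -> x = y.
Proof.
move=> xy; apply/eqP; rewrite -subr_eq0 -(dnorm_eq0 form); apply/eqP.
set z := x - y; suff z0 v : form z v = 0 by [].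
have /coord_span -> : v \in <<[tuple e i | i < n]>>%VS by rewrite onb_span memvf.
rewrite linear_sumr big1 // => i _.
by rewrite -tnth_nth tnth_mktuple linearZr_LR /= linearBl /= xy subrr mulr0.
Qed.

Lemma onb_expand x : x = \sum_i form x (e i) *: e i.
Proof. by apply: onb_ext => i; rewrite onb_coord. Qed.

Lemma onb_form x y : form x y = \sum_i form x (e i) * (form y (e i))^*.
Proof.
rewrite {1}(onb_expand y) linear_sumr; apply: eq_bigr => i _.
by rewrite linearZr_LR /= mulrC.
Qed.

End Expansion.

Lemma orthonormal_extend (s : seq H) : orthonormal form s ->
  exists2 t, orthonormal form (s ++ t) & size (s ++ t) = n.
Proof.
have [m] := ubnP (n - size s); elim: m s => // m IHm s sm s_on.
have s_free := orthonormal_free s_on.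
have dspan : \dim <<s>> = size s by apply/eqP.
have [sn|ns] := leqP n (size s).
  exists [::]; rewrite cats0 //; apply/eqP; rewrite eqn_leq sn andbT.
  by rewrite -dspan dimvS ?subvf.
have : (0 < \dim (orthov form <<s>>))%N.
  by have := dim_orthov form <<s>>; rewrite dspan; move: ns; clear; lia.
rewrite lt0n dimv_eq0 -vpick0; set v := vpick _ => v0.
have vs : orthogonal form s [:: v].
  by rewrite orthogonalE orthov_sym span_seq1 -memvE (memv_pick (orthov form <<s>>)).
have w1 := dnorm_normalize v0; set w := normalize v in w1.
have ws : orthonormal form (s ++ [:: w]).
  rewrite orthonormal_cat s_on /=; apply/andP; split.
    by rewrite /orthonormal /= w1 eqxx.
  apply/orthogonalP => x y xs; rewrite inE => /eqP ->.
  by rewrite linearZr_LR /= (orthogonalP vs x v) ?mulr0 ?mem_head.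
have [|t t_on tn] := IHm _ _ ws; first by rewrite size_cat /=; move: sm ns; clear; lia.
by exists (w :: t); rewrite -cat1s catA.
Qed.

Lemma orthonormal_basis_of_seq (s : seq H) : orthonormal form s -> size s = n ->
  orthonormal_basis (fun i => s`_i).
Proof.
move=> /orthonormalP[s_uniq sP] sn i j.
by rewrite sP ?mem_nth ?sn // nth_uniq ?sn.
Qed.

Lemma normalize_onb (v : 'I_n -> H) : (forall i, v i != 0) ->
  (forall i j, i != j -> form (v i) (v j) = 0) ->
  orthonormal_basis (fun i => normalize (v i)).
Proof.
move=> v0 vP i j; have [<-|ij] := eqVneq i j; first exact: dnorm_normalize.
by rewrite linearZl_LR linearZr_LR /= (vP _ _ ij) !mulr0.
Qed.

Section SemilinearMap.
Variables (s : {rmorphism C -> C}) (e e' : 'I_n -> H).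
Hypothesis sJ : forall a, s a^* = (s a)^*.
Hypotheses (e_onb : orthonormal_basis e) (e'_onb : orthonormal_basis e').

Definition semilinear_map x := \sum_i s (form x (e i)) *: e' i.

Lemma semilinear_map_coord x i : form (semilinear_map x) (e' i) = s (form x (e i)).
Proof. exact: (onb_coord e'_onb). Qed.

Lemma semilinear_mapP a x y :
  semilinear_map (a *: x + y) = s a *: semilinear_map x + semilinear_map y.
Proof.
apply: (onb_ext e'_onb) => i.
rewrite linearDl linearZl_LR /= !semilinear_map_coord.
by rewrite linearDl linearZl_LR /= rmorphD rmorphM.
Qed.

Lemma semilinear_map_form x y : form (semilinear_map x) (semilinear_map y) = s (form x y).
Proof.
rewrite (onb_form e'_onb) (onb_form e_onb) rmorph_sum; apply: eq_bigr => i _.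
by rewrite !semilinear_map_coord rmorphM /= sJ.
Qed.

End SemilinearMap.

Lemma semilinear_mapK (s : {rmorphism C -> C}) e e' : involutive s ->
  orthonormal_basis e -> orthonormal_basis e' ->
  cancel (semilinear_map s e e') (semilinear_map s e' e).
Proof.
move=> sK e_onb e'_onb x; apply: (onb_ext e_onb) => i.
by rewrite !semilinear_map_coord // sK.
Qed.

End OrthonormalBases.

(** * Orthogonality-preserving maps of lines *)

(** Lines are represented by arbitrary generators: [u] need not be linear, nor
    even map proportional vectors to proportional ones. *)
Section Uhlhorn.
Variables (C : numClosedFieldType) (H : vectType C).
Variable form : {dot H for Num.conj}.
Local Notation n := (\dim {:H}).
Variable u : H -> H.
Hypothesis n_ge3 : (2 < n)%N.
Hypothesis u_neq0 : forall x, x != 0 -> u x != 0.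
Hypothesis u_orth : forall x y, x != 0 -> y != 0 ->
  (form (u x) (u y) == 0) = (form x y == 0).

Variable e : 'I_n -> H.
Hypothesis e_onb : orthonormal_basis form e.
Variable i0 : 'I_n.

Definition image_onb i := normalize form (u (e i)).
Local Notation e' := image_onb.

Let e_neq0 i : e i != 0.
Proof. by rewrite -(dnorm_eq0 form) e_onb eqxx oner_eq0. Qed.

Lemma image_onbP : orthonormal_basis form e'.
Proof.
apply: (normalize_onb (v := fun i => u (e i))) => [i|i j ij].
  exact: u_neq0.
by apply/eqP; rewrite u_orth // e_onb (negPf ij).
Qed.
Local Notation e'_onb := image_onbP.

Lemma image_coord_eq0 x i : x != 0 -> (form (u x) (e' i) == 0) = (form x (e i) == 0).
Proof.
move=> x0; rewrite linearZr_LR /= mulf_eq0 u_orth // conjC_eq0.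
by rewrite (negPf (normalize_scalar_neq0 form (u_neq0 (e_neq0 i)))).
Qed.

Lemma coord_neq0 x i : form x (e i) != 0 -> x != 0.
Proof. by apply: contra_neq => ->; rewrite linear0l. Qed.

Definition plane_vector j l a b : H := e i0 + a *: e j + b *: e l.

(** The [j]-th coordinate of the image of [e i0 + a *: e j], once its [i0]-th
    coordinate is normalised to 1. *)
Definition slope j a :=
  form (u (plane_vector j j a 0)) (e' j) / form (u (plane_vector j j a 0)) (e' i0).

Lemma plane_coord j l a b i : form (plane_vector j l a b) (e i) =
  (i0 == i)%:R + a * (j == i)%:R + b * (l == i)%:R.
Proof. by rewrite !linearDl !linearZl_LR /= !e_onb. Qed.

Lemma form_u_sum2 x y j : i0 != j -> y != 0 ->
  (forall i, i != i0 -> i != j -> form y (e i) = 0) ->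
  form (u x) (u y) = form (u x) (e' i0) * (form (u y) (e' i0))^* +
                     form (u x) (e' j) * (form (u y) (e' j))^*.
Proof.
move=> i0j y0 yP; rewrite (onb_form e'_onb) (bigD1 i0) //= (bigD1 j) /=; last first.
  by rewrite eq_sym.
rewrite big1 ?addr0 // => i /andP[ii0 ij].
have /eqP -> : form (u y) (e' i) == 0 by rewrite image_coord_eq0 // yP.
by rewrite rmorph0 mulr0.
Qed.

Lemma plane_neq0 j l a b : i0 != j -> i0 != l ->
  form (plane_vector j l a b) (e i0) = 1 /\ plane_vector j l a b != 0.
Proof.
move=> /negPf ij /negPf il.
have E : form (plane_vector j l a b) (e i0) = 1.
  by rewrite plane_coord eqxx [j == _]eq_sym ij [l == _]eq_sym il !mulr0 !addr0.
by split=> //; apply: (@coord_neq0 _ i0); rewrite E oner_eq0.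
Qed.

Lemma slope0 j : i0 != j -> slope j 0 = 0.
Proof.
move=> ij; have [_ P0] := @plane_neq0 j j 0 0 ij ij; rewrite /slope.
have /eqP -> : form (u (plane_vector j j 0 0)) (e' j) == 0.
  by rewrite image_coord_eq0 // plane_coord (negPf ij) !mul0r !addr0.
by rewrite mul0r.
Qed.

(** The image of [e i0 + s *: e j] has only two nonzero coordinates, so that
    orthogonality to it is a relation between two coordinates of [u x]. *)
Lemma slope_orth x j s : i0 != j -> form x (e i0) != 0 ->
  form x (e i0) + form x (e j) * s^* = 0 ->
  form (u x) (e' i0) + form (u x) (e' j) * (slope j s)^* = 0.
Proof.
move=> ij x0 xs; have [P1 P0] := @plane_neq0 j j s 0 ij ij.
set y := plane_vector j j s 0 in P1 P0.
have yE i : form y (e i) = (i0 == i)%:R + s * (j == i)%:R.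
  by rewrite plane_coord mul0r addr0.
have yxP i : i != i0 -> i != j -> form y (e i) = 0.
  by move=> /negPf i1 /negPf i2; rewrite yE eq_sym i1 eq_sym i2 mulr0 addr0.
have xy : form x y = 0.
  rewrite /y /plane_vector scale0r addr0 linearDr linearZr_LR /= [s^* * _]mulrC.
  exact: xs.
have xn0 := coord_neq0 x0.
have := u_orth xn0 P0; rewrite xy eqxx => /eqP.
rewrite (form_u_sum2 x ij P0 yxP).
have y'0 : (form (u y) (e' i0))^* != 0.
  by rewrite conjC_eq0 image_coord_eq0 // P1 oner_eq0.
move=> E; apply: (mulIf y'0); rewrite mul0r -[RHS]E /slope -/y fmorph_div.
by rewrite mulrDl -mulrA divfK.
Qed.

(** The vector [x] and [e i0 + t *: e j] satisfy the same relation
    [slope_orth], for the value of [s] that makes both orthogonal to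
    [e i0 + s *: e j]; the case [t = 0], where there is no such [s], is
    orthogonality to [e j]. *)
Lemma image_coord x j : i0 != j -> form x (e i0) != 0 ->
  form (u x) (e' j) = form (u x) (e' i0) * slope j (form x (e j) / form x (e i0)).
Proof.
move=> ij x0; have xn0 := coord_neq0 x0.
set t := _ / _.
have xj : form x (e j) = t * form x (e i0) by rewrite divfK.
have [t0|t0] := eqVneq t 0.
  rewrite t0 slope0 // mulr0; apply/eqP.
  by rewrite image_coord_eq0 // xj t0 mul0r.
pose s := - (t^-1)^*.
have E1 : form (u x) (e' i0) + form (u x) (e' j) * (slope j s)^* = 0.
  apply: slope_orth => //; rewrite xj rmorphN /= conjCK mulrN mulrAC divff //.
  by rewrite mul1r subrr.
have [P1 P0] := @plane_neq0 j j t 0 ij ij.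
set y := plane_vector j j t 0 in P1 P0.
have E2 : form (u y) (e' i0) + form (u y) (e' j) * (slope j s)^* = 0.
  apply: slope_orth; rewrite // P1 ?oner_eq0 //.
  rewrite plane_coord (negPf ij) eqxx add0r mul0r addr0 mulr1.
  by rewrite rmorphN /= conjCK mulrN divff // subrr.
have y'0 : form (u y) (e' i0) != 0 by rewrite image_coord_eq0 // P1 oner_eq0.
have E3 : 1 + slope j t * (slope j s)^* = 0.
  by apply: (mulIf y'0); rewrite mul0r mulrDl mul1r mulrAC /slope divfK.
have sn0 : (slope j s)^* != 0.
  by apply: contra_eq_neq E3 => ->; rewrite mulr0 addr0 oner_eq0.
apply: (mulIf sn0); apply: (addrI (form (u x) (e' i0))); rewrite E1 -mulrA.
by rewrite -{1}(mulr1 (form _ _)) -mulrDr E3 mulr0.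
Qed.

Lemma slope_line_equation j l : i0 != j -> i0 != l -> j != l ->
  line_equation (slope j) (slope l).
Proof.
move=> ij il jl x s y t E.
have [P1 P0] := @plane_neq0 j l x y ij il.
have [Q1 Q0] := @plane_neq0 j l s t ij il.
set p := plane_vector j l x y in P1 P0; set q := plane_vector j l s t in Q1 Q0.
have pj : form p (e j) = x.
  by rewrite plane_coord (negPf ij) eqxx [l == _]eq_sym (negPf jl) mulr1 mulr0 addr0 add0r.
have pl : form p (e l) = y.
  by rewrite plane_coord (negPf il) eqxx (negPf jl) mulr1 mulr0 !add0r.
have qj : form q (e j) = s.
  by rewrite plane_coord (negPf ij) eqxx [l == _]eq_sym (negPf jl) mulr1 mulr0 addr0 add0r.
have ql : form q (e l) = t.
  by rewrite plane_coord (negPf il) eqxx (negPf jl) mulr1 mulr0 !add0r.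
have pq : form p q = 0.
  rewrite /q /plane_vector !linearDr !linearZr_LR /= P1 pj pl.
  rewrite -/p [s^* * _]mulrC [t^* * _]mulrC.
  exact: E.
have p'0 : form (u p) (e' i0) != 0 by rewrite image_coord_eq0 // P1 oner_eq0.
have q'0 : (form (u q) (e' i0))^* != 0.
  by rewrite conjC_eq0 image_coord_eq0 // Q1 oner_eq0.
have := u_orth P0 Q0; rewrite pq eqxx => /eqP.
rewrite (onb_form e'_onb) (bigD1 i0) //= (bigD1 j) /=; last by rewrite eq_sym.
rewrite (bigD1 l) /=; last by rewrite eq_sym il eq_sym.
rewrite big1 ?addr0; last first.
  move=> i /andP[/andP[/negPf ii0 /negPf ij'] /negPf il'].
  have /eqP -> : form (u p) (e' i) == 0; last by rewrite mul0r.
  by rewrite image_coord_eq0 // plane_coord ![_ == i]eq_sym ii0 ij' il' !mulr0 !addr0.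
rewrite !(@image_coord _ j) ?P1 ?Q1 ?oner_eq0 // !(@image_coord _ l) ?P1 ?Q1 ?oner_eq0 //.
rewrite pj pl qj ql !divr1 !rmorphM /= => E'.
apply: (mulfI (mulf_neq0 p'0 q'0)); rewrite mulr0 -[RHS]E'; ring.
Qed.

(** The functional equation needs two coordinates besides [i0], hence dimension
    at least 3. *)
Lemma third_index j : exists2 l, i0 != l & j != l.
Proof.
have : ~~ [forall l, (l == i0) || (l == j)].
  apply/negP => /forallP all2; have : (#|[set: 'I_n]| <= #|[set i0; j]|)%N.
    by apply/subset_leq_card/fintype.subsetP => l _; rewrite !inE all2.
  by rewrite cardsT card_ord cards2; move: n_ge3; case: (i0 != j); clear; lia.
rewrite negb_forall => /existsP[l]; rewrite negb_or => /andP[li lj].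
by exists l; rewrite eq_sym.
Qed.

(** Any two slopes share their endomorphism by [line_equation_endomorphism], so
    one fixed [j1] determines it for all. *)
Lemma slope_endomorphism : exists s : {rmorphism C -> C},
  (forall a, s a^* = (s a)^*) /\
  (forall j, i0 != j -> slope j 1 * (slope j 1)^* = 1 /\
     forall a, slope j a = slope j 1 * s a).
Proof.
have norm1 j : i0 != j -> slope j 1 * (slope j 1)^* = 1.
  move=> ij; have [l il jl] := third_index j.
  exact: (line_equation_norm1 (slope_line_equation ij il jl) (slope0 il)).
have [j1 ij1 _] := third_index i0; have [l1 il1 jl1] := third_index j1.
have [s [sj1 _ sJ]] := line_equation_endomorphism
  (slope_line_equation ij1 il1 jl1) (slope0 ij1) (slope0 il1).
exists s; split=> // j ij; split; first exact: norm1.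
have [->//|jj1] := eqVneq j j1.
rewrite eq_sym in jj1.
have [s' [s'j1 s'j _]] := line_equation_endomorphism
  (slope_line_equation ij1 ij jj1) (slope0 ij1) (slope0 ij).
have j1_neq0 : slope j1 1 != 0.
  by apply: contra_eq_neq (norm1 _ ij1) => ->; rewrite mul0r eq_sym oner_eq0.
by move=> a; rewrite s'j; congr (_ * _); apply: (mulfI j1_neq0); rewrite -sj1 -s'j1.
Qed.

Section Conclusion.
Variable s : {rmorphism C -> C}.
Hypotheses (sK : involutive s) (sJ : forall a, s a^* = (s a)^*).
Hypothesis s_slope : forall j, i0 != j -> slope j 1 * (slope j 1)^* = 1 /\
  forall a, slope j a = slope j 1 * s a.

(** The basis [image_onb] is only determined up to phases; these are the ones for
    which the semilinear map below induces [u]. *)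
Definition phase i := if i0 == i then 1 else slope i 1.

Definition twisted_onb i := phase i *: e' i.

Lemma twisted_onbP : orthonormal_basis form twisted_onb.
Proof.
move=> i j; rewrite linearZl_LR linearZr_LR /= e'_onb.
have [<-|_] := eqVneq i j; last by rewrite !mulr0.
rewrite mulr1 /phase; case: eqVneq => [_|/s_slope[] //].
by rewrite rmorph1 mulr1.
Qed.

Local Notation U := (semilinear_map form s e twisted_onb).

Lemma twisted_coord x i : form (U x) (e' i) = s (form x (e i)) * phase i.
Proof.
rewrite -(onb_coord e'_onb (fun i => s (form x (e i)) * phase i)).
by congr (form _ _); apply: eq_bigr => j _; rewrite scalerA.
Qed.

Lemma image_generic x : form x (e i0) != 0 -> exists k, u x = k *: U x.
Proof.
move=> x0; exists (form (u x) (e' i0) / s (form x (e i0))).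
have sx0 : s (form x (e i0)) != 0 by rewrite fmorph_eq0.
apply: (onb_ext e'_onb) => i; rewrite linearZl_LR /= twisted_coord.
have [<-|ij] := eqVneq i0 i; first by rewrite /phase eqxx mulr1 divfK.
rewrite image_coord // (s_slope ij).2 /phase (negPf ij) fmorph_div.
by field.
Qed.

(** When the [i0]-coordinate of [x] vanishes, pull [u x] back to a vector [z].
    Every [y] orthogonal to [x] with nonzero [i0]-coordinate is orthogonal to
    [z], by the generic case.  Adding [e i0] reaches the other [y] orthogonal to
    [x], so [z] is proportional to [x]. *)
Lemma image_line x : x != 0 -> exists k, u x = k *: U x.
Proof.
move=> xn0; have [x0|/image_generic//] := eqVneq (form x (e i0)) 0.
pose z := semilinear_map form s twisted_onb e (u x).
have Uz : U z = u x := semilinear_mapK sK twisted_onbP e_onb (u x).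
have U_form := semilinear_map_form sJ e_onb twisted_onbP.
have generic y : form y (e i0) != 0 -> form y x = 0 -> form y z = 0.
  move=> y0 yx; have yn0 := coord_neq0 y0; have [k uy] := image_generic y0.
  have k0 : k != 0.
    by apply: contraNneq (u_neq0 yn0); rewrite uy => ->; rewrite scale0r.
  have : form (u y) (u x) == 0 by rewrite u_orth // yx eqxx.
  rewrite uy linearZl_LR /= -Uz U_form.
  by rewrite mulf_eq0 (negPf k0) fmorph_eq0 => /eqP.
have perp y : form y x = 0 -> form y z = 0.
  move=> yx; have [y0|] := eqVneq (form y (e i0)) 0; last by move/generic; apply.
  have e0x : form (e i0) x = 0 by rewrite dotC x0 rmorph0.
  have e0z : form (e i0) z = 0 by apply: generic; rewrite ?e_onb ?eqxx ?oner_eq0.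
  have : form (y + e i0) z = 0.
    apply: generic; rewrite linearDl /= ?y0 ?yx ?e0x ?addr0 //.
    by rewrite add0r e_onb eqxx oner_eq0.
  by rewrite linearDl /= e0z addr0.
pose k := form z x / form x x; pose y := z - k *: x.
have yx : form y x = 0.
  by rewrite /y linearBl linearZl_LR /= divfK ?subrr // dnorm_eq0.
have : form y y = 0.
  by rewrite {2}/y linearBr linearZr_LR /= perp // yx mulr0 subrr.
move/eqP; rewrite dnorm_eq0 subr_eq0 => /eqP zE.
have U0 : U 0 = 0.
  by rewrite /semilinear_map big1 // => i _; rewrite linear0l rmorph0 scale0r.
exists (s k); rewrite -Uz zE -[k *: x]addr0.
by rewrite (semilinear_mapP s e twisted_onbP) U0 addr0.
Qed.

End Conclusion.
End Uhlhorn.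

(** * Unitary and antiunitary operators *)

Section Semiunitary.
Variables (C : numClosedFieldType) (H : vectType C).
Variable form : {dot H for Num.conj}.
Implicit Types (s : {rmorphism C -> C}) (U V : H -> H) (X Y : {vspace H}).

(** Covers unitary operators ([s] the identity) and antiunitary ones ([s] the
    conjugation) at once; [V] is the inverse of [U]. *)
Definition semiunitary s U V := [/\ cancel U V, cancel V U,
  forall a x y, U (a *: x + y) = s a *: U x + U y &
  forall x y, form (U x) (U y) = s (form x y)].

Lemma semiunitary_inv s U V : involutive s -> semiunitary s U V -> semiunitary s V U.
Proof.
move=> sK [UK VK UL Uf]; split=> // [a x y|x y].
  by apply: (can_inj UK); rewrite VK UL sK !VK.
by apply: (inv_inj sK); rewrite -Uf !VK sK.
Qed.

(** Image of a subspace, available for maps that are linear only up to a field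
    automorphism. *)
Definition image_space U X : {vspace H} := <<map U (vbasis X)>>%VS.

Section Images.
Variables (s : {rmorphism C -> C}) (U V : H -> H).
Hypothesis UV : semiunitary s U V.

Lemma semiunitary_span (b : seq H) Y : {in b, forall x, U x \in Y} ->
  {in <<b>>%VS, forall x, U x \in Y}.
Proof.
have [_ _ UL _] := UV.
have U0 : U 0 = 0.
  by have /eqP := UL 1 0 0; rewrite scaler0 addr0 rmorph1 scale1r eq_sym addrC
    -subr_eq0 addrK => /eqP.
have UZ a x : U (a *: x) = s a *: U x by rewrite -[a *: x]addr0 UL U0 addr0.
have UD x y : U (x + y) = U x + U y by rewrite -[x]scale1r UL rmorph1 !scale1r.
move=> Ub x; rewrite -[b]in_tupleE => /coord_span ->.
elim/big_ind: _ => [|x1 x2 X1 X2|i _]; rewrite ?U0 ?UD ?mem0v ?memvD //.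
by rewrite UZ memvZ // Ub // mem_nth.
Qed.

Lemma image_space_mem X x : x \in X -> U x \in image_space U X.
Proof.
rewrite -{1}(span_basis (vbasisP X)); apply: semiunitary_span => z zX.
by rewrite memv_span ?map_f.
Qed.

Lemma dim_image_space_le X : (\dim (image_space U X) <= \dim X)%N.
Proof. by rewrite (leq_trans (dim_span _)) // size_map size_tuple. Qed.

End Images.

Section InvolutiveImages.
Variables (s : {rmorphism C -> C}) (U V : H -> H).
Hypotheses (sK : involutive s) (UV : semiunitary s U V).
Let VU := semiunitary_inv sK UV.

Lemma mem_image_space X y : (y \in image_space U X) = (V y \in X).
Proof.
have [UK VK _ _] := UV; apply/idP/idP => [|/(image_space_mem UV)]; last by rewrite VK.
by apply: (semiunitary_span VU) => _ /mapP[x xX ->]; rewrite UK vbasis_mem.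
Qed.

Lemma dim_image_space X : \dim (image_space U X) = \dim X.
Proof.
apply/eqP; rewrite eqn_leq dim_image_space_le.
apply: leq_trans (dim_image_space_le V _); rewrite dimvS //.
apply/subvP => x xX; have [UK _ _ _] := UV.
by rewrite -(UK x); apply/(image_space_mem VU)/(image_space_mem UV).
Qed.

End InvolutiveImages.
End Semiunitary.

(** * Conclusion *)

Section LineMaps.
Variables (C : numClosedFieldType) (H : vectType C).
Variable form : {dot H for Num.conj}.
Implicit Types (x y z : H).
Local Notation n := (\dim {:H}).

Lemma orthogonal_component (x y : H) : x != 0 ->
  exists k z, [/\ y = k *: x + z & form x z = 0].
Proof.
move=> x0; pose k := form y x / form x x; exists k, (y - k *: x).
split; first by rewrite addrC subrK.
rewrite dotC linearBl linearZl_LR /= divfK ?subrr ?rmorph0 //.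
by rewrite dnorm_eq0.
Qed.

Variable L : {vspace H} -> {vspace H}.
Hypothesis L_rank : rank_preserving 1 L.
Hypothesis L_inj : forall p q, \dim p = 1%N -> \dim q = 1%N -> L p = L q -> p = q.
Hypothesis L_orth : forall p q, \dim p = 1%N -> \dim q = 1%N ->
  (p <= orthov form q)%VS -> (L p <= orthov form (L q))%VS.

Definition line_gen x : H := vpick (L <[x]>).

Lemma dim_line (x : H) : x != 0 -> \dim <[x]>%VS = 1%N.
Proof. by rewrite dim_vline => ->. Qed.

Lemma line_gen_neq0 x : x != 0 -> line_gen x != 0.
Proof. by move=> x0; rewrite vpick0 -dimv_eq0 L_rank ?dim_line. Qed.

Lemma line_genE x : x != 0 -> L <[x]> = <[line_gen x]>%VS.
Proof.
move=> x0; apply/esym/eq_of_sub_dim; first by rewrite -memvE memv_pick.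
by rewrite L_rank ?dim_line // line_gen_neq0.
Qed.

Lemma line_gen_orth x y : x != 0 -> y != 0 -> form x y = 0 ->
  form (line_gen x) (line_gen y) = 0.
Proof.
move=> x0 y0 xy; apply/eqP; rewrite -orthov11 -!line_genE //.
by apply: L_orth; rewrite ?dim_line // orthov11; apply/eqP.
Qed.

(** Suppose the images of [x] and [y] are orthogonal, and let [z] be the
    component of [y] orthogonal to [x].  Complete [x], [z] to an orthogonal basis:
    the image of [y] is orthogonal to the images of all basis vectors except
    that of [z], hence equals the image of the line of [z].  By injectivity [y]
    is proportional to [z], so orthogonal to [x]. *)
Lemma line_gen_orthE x y : x != 0 -> y != 0 ->
  (form (line_gen x) (line_gen y) == 0) = (form x y == 0).
Proof.
move=> x0 y0; apply/idP/idP => [/eqP uxy|/eqP/(line_gen_orth x0 y0) -> //].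
have [k [z [yE xz]]] := orthogonal_component y x0.
have [z0|z0] := eqVneq z 0.
  (* [x] and [y] span the same line, whose image is not isotropic *)
  have xy : (<[y]> <= <[x]>)%VS by rewrite -memvE yE z0 addr0 memvZ ?memv_line.
  have Lxy : L <[x]> = L <[y]>.
    by congr (L _); apply/esym/eq_of_sub_dim; rewrite ?dim_line.
  have : (L <[x]> <= orthov form (L <[x]>))%VS.
    by rewrite {2}Lxy !line_genE // orthov11; apply/eqP.
  have LX0 := orthov_disjoint (P := L <[x]>) _ (subvv _) (subvv _).
  by move=> /LX0 E; have := L_rank (dim_line x0); rewrite E dimv0.
(* complete the orthogonal pair x, z to an orthonormal basis *)
have xz_on : orthonormal form [:: normalize form x; normalize form z].
  apply/orthonormal2P; split; rewrite ?dnorm_normalize //.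
  by rewrite linearZl_LR linearZr_LR /= xz !mulr0.
have [t t_on tn] := orthonormal_extend xz_on.
set b := _ ++ _ in t_on tn.
have b_onb := orthonormal_basis_of_seq t_on tn.
have b_neq0 i : b`_(i : 'I_n) != 0.
  by rewrite -(dnorm_eq0 form) b_onb eqxx oner_eq0.
have n2 : (1 < n)%N by rewrite -tn.
pose i0 := Ordinal (ltnW n2); pose i1 := Ordinal n2.
have b'_onb : orthonormal_basis form
    (fun i : 'I_n => normalize form (line_gen b`_i)).
  apply: (normalize_onb (v := fun i : 'I_n => line_gen b`_i)) => [i|i j ij].
    exact: line_gen_neq0.
  by apply: line_gen_orth; rewrite // b_onb (negPf ij).
have line_norm v : v != 0 -> L <[normalize form v]> = L <[v]>.
  move=> v0; congr (L _); apply: eq_of_sub_dim; first by rewrite -memvE memvZ ?memv_line.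
  by rewrite !dim_vline scaler_eq0 (negPf (normalize_scalar_neq0 form v0)) (negPf v0).
have bi i : i != i0 -> i != i1 -> form x b`_i = 0 /\ form z b`_i = 0.
  move=> ii0 ii1.
  have h0 := b_onb i0 i; have h1 := b_onb i1 i.
  move: h0 h1; rewrite /= eq_sym (negPf ii0) eq_sym (negPf ii1) !linearZl_LR /=.
  move=> /eqP; rewrite mulf_eq0 (negPf (normalize_scalar_neq0 form x0)) /= => /eqP ->.
  by move=> /eqP; rewrite mulf_eq0 (negPf (normalize_scalar_neq0 form z0)) /= => /eqP ->.
have uyE : line_gen y \in L <[z]>.
  rewrite (onb_expand b'_onb (line_gen y)) (bigD1 i1) //= big1 ?addr0 => [|i ii1].
    by rewrite !memvZ // -line_norm // line_genE ?memv_line //; apply: (b_neq0 i1).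
  rewrite linearZr_LR /=; suff -> : form (line_gen y) (line_gen b`_i) = 0.
    by rewrite mulr0 scale0r.
  have [->|ii0] := eqVneq i i0; last first.
    have [xi zi] := bi i ii0 ii1.
    by apply: line_gen_orth => //; rewrite yE linearDl linearZl_LR /= xi zi mulr0 addr0.
  apply/eqP; rewrite -orthov11 orthov_sym -[X in (X <= _)%VS]line_genE; last exact: (b_neq0 i0).
  by rewrite line_norm // line_genE // orthov11; apply/eqP.
have Lyz : L <[y]> = L <[z]>.
  by apply: eq_of_sub_dim; rewrite ?line_genE -?memvE // -?line_genE // !L_rank ?dim_line.
have yz : y \in <[z]>%VS by rewrite -(L_inj _ _ Lyz) ?memv_line ?dim_line.
by move/vlineP: yz => [a ->]; rewrite linearZr_LR /= xz mulr0.
Qed.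

End LineMaps.

Section Wigner.
Local Open Scope complex_scope.
Variables (R : realType) (H : vectType R[i]) (form : {dot H for Num.conj}).
Local Notation n := (\dim {:H}).

Lemma orthogonality_map_semiunitary (u : H -> H) : (2 < n)%N ->
  (forall x, x != 0 -> u x != 0) ->
  (forall x y, x != 0 -> y != 0 -> (form (u x) (u y) == 0) = (form x y == 0)) ->
  exists (s : {rmorphism R[i] -> R[i]}) (U V : H -> H), [/\ involutive s, semiunitary form s U V,
    s =1 id \/ s =1 Num.conj & forall x, x != 0 -> exists k, u x = k *: U x].
Proof.
move=> n3 u0 uo.
have [e e_onb] : exists e, orthonormal_basis form e.
  have [|t t_on tn] := @orthonormal_extend _ _ form [::]; first by [].
  by exists (fun i => ([::] ++ t)`_i); apply: orthonormal_basis_of_seq.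
pose i0 := Ordinal (ltnW (ltnW n3)).
have [s [sJ s_slope]] := slope_endomorphism n3 u0 uo e_onb i0.
have s_cases := endomorphism_id_or_conj sJ.
have sK : involutive s.
  by move=> a; case: s_cases => sE; rewrite !sE ?conjCK.
have t_onb := twisted_onbP u0 uo e_onb s_slope.
set e1 := twisted_onb form u e i0 in t_onb.
exists s, (semilinear_map form s e e1), (semilinear_map form s e1 e).
split=> //; last exact: (image_line u0 uo e_onb sK sJ s_slope).
split.
- exact: semilinear_mapK.
- exact: semilinear_mapK.
- exact: semilinear_mapP.
- exact: semilinear_map_form.
Qed.

Lemma orthogonal_spacesE (X Y : {vspace H}) :
  orthogonal_spaces form X Y <-> (X <= orthov form Y)%VS.
Proof. by split=> [?|/orthovP]; first exact/orthovP. Qed.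

Lemma semiunitary_operators s U V : semiunitary form s U V ->
  s =1 id \/ s =1 Num.conj ->
  unitary_operator form U \/ antiunitary_operator form U.
Proof.
move=> [UK VK UL Uf] [] sE; [left|right]; split; try by exists V.
- by move=> a x y; rewrite UL sE.
- by move=> x y; apply: etrans (Uf x y) (sE _).
- by move=> a x y; rewrite UL sE.
- by move=> x y; apply: etrans (Uf x y) (sE _).
Qed.

End Wigner.

Local Open Scope complex_scope.

Theorem theorem2 (R : realType) (H : vectType R[i]) (form : inner_product H)
    (k : nat) (dimH_ge3 : (3 <= \dim {:H})%N) (k_ge1 : (1 <= k)%N)
    (dimH_gt2k : (2 * k < \dim {:H})%N)
    (f : grassmannian H k -> grassmannian H k)
    (f_orth : preserves_orthogonality form f) :
  bijective f /\
  exists U : H -> H,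
    (unitary_operator form U \/ antiunitary_operator form U) /\
    induced_by f U.
Proof.
pose F (X : {vspace H}) : {vspace H} :=
  if insub X is Some X' then val (f X') else 0%VS.
have FE (X : grassmannian H k) : F (val X) = val (f X) by rewrite /F valK.
have lift (X : {vspace H}) : \dim X = k -> exists X' : grassmannian H k, X = val X'.
  by move=> /eqP dX; exists (exist _ X dX).
have F_rank : rank_preserving k F.
  by move=> _ /lift[X ->]; rewrite FE; exact/eqP/(valP (f X)).
have F_orth X Y : \dim X = k -> \dim Y = k ->
    (F X <= orthov form (F Y))%VS = (X <= orthov form Y)%VS.
  move=> /lift[X' ->] /lift[Y' ->]; rewrite !FE.
  by apply/idP/idP => /orthogonal_spacesE XY;
    apply/orthogonal_spacesE; exact/(f_orth X' Y').
have [L [L_rank LF L_inj L_orth]] := line_map_exists k_ge1 dimH_gt2k F_rank F_orth.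
have [s [U [V [sK UV s_cases uU]]]] := orthogonality_map_semiunitary dimH_ge3
  (line_gen_neq0 L_rank) (line_gen_orthE L_rank L_inj L_orth).
have [UK VK _ Uf] := UV.
have U_sub (X : grassmannian H k) x : x \in val X -> U x \in val (f X).
  move=> xX; have [x0|x0] := eqVneq x 0.
    suff -> : U x = 0 by rewrite mem0v.
    by apply/eqP; rewrite -(dnorm_eq0 form) Uf x0 linear0l rmorph0.
  have [c uE] := uU x x0.
  have c0 : c != 0.
    by apply: contraNneq (line_gen_neq0 L_rank x0); rewrite uE => ->; rewrite scale0r.
  rewrite -(scalerK c0 (U x)) -uE memvZ // -FE.
  apply: (subvP (LF <[x]>%VS (val X) _ _ _)).
  - exact: dim_line.
  - exact/eqP/(valP X).
  - by rewrite -memvE.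
  exact: memv_pick.
have f_image (X : grassmannian H k) : val (f X) = image_space U (val X).
  apply/vspaceP => y; rewrite (mem_image_space sK UV); apply/idP/idP => [yfX|VyX].
    (* test [V y] against the [k]-subspaces of the orthocomplement of [X] *)
    rewrite -[val X](orthovK form); apply/mem_orthovP => t tX.
    have dX := eqP (valP X).
    have [t0|t0] := eqVneq t 0; first by rewrite t0 linear0r.
    have [T /andP[tT TX] /lift[T' TE]] :
        exists2 T, (<[t]> <= T <= orthov form (val X))%VS & \dim T = k.
      by apply: subspace_through; rewrite // k_ge1 andTb leq_dim_orthov.
    move: tT TX; rewrite {}TE -memvE => tT TX.
    have : orthogonal_spaces form (val (f T')) (val (f X)).
      by apply: (f_orth T' X).1; apply/orthogonal_spacesE.
    move=> /(_ (U t) y (U_sub _ _ tT) yfX) /eqP.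
    by rewrite -{1}(VK y) Uf fmorph_eq0 dotC conjC_eq0 => /eqP.
  by rewrite -(VK y) U_sub.
split.
  have VU := semiunitary_inv sK UV.
  have g_dim (X : grassmannian H k) : \dim (image_space V (val X)) == k.
    by rewrite (dim_image_space sK VU); apply: valP X.
  pose g X : grassmannian H k := exist _ (image_space V (val X)) (g_dim X).
  exists g => X; apply: val_inj; apply/vspaceP => y /=.
    by rewrite (mem_image_space sK VU) f_image (mem_image_space sK UV) UK.
  by rewrite f_image (mem_image_space sK UV) /= (mem_image_space sK VU) VK.
exists U; split; first exact: semiunitary_operators UV s_cases.
move=> X; apply/seteqP; split=> y /=.
  by rewrite f_image (mem_image_space sK UV) => VyX; exists (V y).
by move=> [x xX <-]; apply: U_sub.
Qed.
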